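(* Let $K$ be a field of characteristic zero, $R=K[X_1,\ldots,X_n]$, $R_{n-1}=K[X_1,\ldots,X_{n-1}]$, and let $M$ be a simple left module over the Weyl algebra $A_n(K)$ with $\mathrm{Ass}_R(M)=\{P\}$. Set $Q=P\cap R_{n-1}$. Then \[H_0(\partial_n;M)=0\implies P=QR,\qquad H_1(\partial_n;M)\ne0\implies P=QR.\]
   Context: $H_0(\partial_n;M)=M/\partial_nM$ and $H_1(\partial_n;M)=\ker(\partial_n\colon M\to M)$ (Koszul homology with respect to the single $K$-linear map $\partial_n$). *)

(* Defs.v *)
From HB Require Import structures.
From mathcomp Require Import all_boot all_order all_algebra.
From mathcomp Require Import mpoly.
Set Implicit Arguments. Unset Strict Implicit. Unset Printing Implicit Defensive.
Import GRing.Theory.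
Local Open Scope ring_scope.

(* A left module over the Weyl algebra A_N(K) = K<x_1..x_N, d_1..d_N> is a
   K-vector space M with K-linear operators X i (mult. by x_i) and D i
   (action of d_i) satisfying the defining relations of A_N(K). *)
Definition weyl_module (K : fieldType) (M : lmodType K) (N : nat)
    (X D : 'I_N -> {linear M -> M}) : Prop :=
  [/\ forall i j v, X i (X j v) = X j (X i v),
      forall i j v, D i (D j v) = D j (D i v) &
      forall i j v, D i (X j v) - X j (D i v) = (if i == j then v else 0)].

Definition weyl_submodule (K : fieldType) (M : lmodType K) (N : nat)
    (X D : 'I_N -> {linear M -> M}) (S : M -> Prop) : Prop :=
  [/\ S 0, (forall u v, S u -> S v -> S (u + v)),
      (forall (a : K) v, S v -> S (a *: v)),
      (forall i v, S v -> S (X i v)) & (forall i v, S v -> S (D i v))].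

Definition weyl_simple (K : fieldType) (M : lmodType K) (N : nat)
    (X D : 'I_N -> {linear M -> M}) : Prop :=
  (exists v : M, v != 0) /\
  forall S, weyl_submodule X D S -> (forall v, S v) \/ (forall v, S v -> v = 0).

Definition mon_act (K : fieldType) (M : lmodType K) (N : nat)
    (X : 'I_N -> {linear M -> M}) (m : 'X_{1..N}) (v : M) : M :=
  foldr (fun i w => iter (m i) (X i) w) v (enum 'I_N).

Definition poly_act (K : fieldType) (M : lmodType K) (N : nat)
    (X : 'I_N -> {linear M -> M}) (p : {mpoly K[N]}) (v : M) : M :=
  \sum_(m <- msupp p) p@_m *: mon_act X m v.

Definition is_ideal (A : comRingType) (I : A -> Prop) : Prop :=
  [/\ I 0, (forall a b, I a -> I b -> I (a + b)) & (forall r a, I a -> I (r * a))].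

Definition is_prime_ideal (A : comRingType) (I : A -> Prop) : Prop :=
  [/\ is_ideal I, ~ I 1 & forall a b, I (a * b) -> I a \/ I b].

Definition ann_R (K : fieldType) (M : lmodType K) (N : nat)
    (X : 'I_N -> {linear M -> M}) (v : M) : {mpoly K[N]} -> Prop :=
  fun p => poly_act X p v = 0.

Definition associated_prime (K : fieldType) (M : lmodType K) (N : nat)
    (X : 'I_N -> {linear M -> M}) (I : {mpoly K[N]} -> Prop) : Prop :=
  is_prime_ideal I /\ exists v : M, forall p, I p <-> ann_R X v p.

Definition Ass_singleton (K : fieldType) (M : lmodType K) (N : nat)
    (X : 'I_N -> {linear M -> M}) (P : {mpoly K[N]} -> Prop) : Prop :=
  forall I, associated_prime X I <-> (forall p, I p <-> P p).

Definition contract_ideal (K : fieldType) (n : nat)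
    (P : {mpoly K[n.+1]} -> Prop) : {mpoly K[n]} -> Prop :=
  fun q => P (mwiden q).

Definition extend_ideal (K : fieldType) (n : nat)
    (Q : {mpoly K[n]} -> Prop) : {mpoly K[n.+1]} -> Prop :=
  fun p => exists s : seq ({mpoly K[n.+1]} * {mpoly K[n]}),
    (forall x, x \in s -> Q x.2) /\ p = \sum_(x <- s) x.1 * mwiden x.2.

(* Koszul homology w.r.t. a single K-linear map d:
   H_0(d;M) = M / dM,  H_1(d;M) = ker d *)
Definition H0_vanishes (K : fieldType) (M : lmodType K) (d : {linear M -> M}) : Prop :=
  forall v : M, exists w : M, v = d w.

Definition H1_nonzero (K : fieldType) (M : lmodType K) (d : {linear M -> M}) : Prop :=
  exists v : M, v != 0 /\ d v = 0.

(* Main.v *)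
(* Simplicity makes the Weyl submodule of vectors killed by a power of f either
   0 or M, so P consists both of the f killing some nonzero vector and of the f
   acting locally nilpotently on M.  In characteristic 0 an ideal stable under
   ∂_n is extended from R_{n-1}: the top X_n-coefficient is reached by iterating
   ∂_n.  So it suffices that f in P implies f' = ∂_n f in P.
   - If ∂_n v = 0 with v <> 0, let f^(k+1) be the first power of f killing v;
     applying ∂_n to f^(k+1) v = 0 shows that f' kills f^k v <> 0.
   - If f' is not in P, then f' is injective on M.  Given f u = 0 and
     ∂_n w = f' u, applying ∂_n to f^(k+1) w = 0 gives f' f^k w = 0, hence
     f^k w = 0; descending, w = 0 and u = 0.  So ∂_n is not onto. *)
Require Import Defs.
From HB Require Import structures.
From mathcomp Require Import all_boot all_order all_algebra.
From mathcomp Require Import mpoly ssrcomplements.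
Local Open Scope ring_scope.

Set Implicit Arguments. Unset Strict Implicit. Unset Printing Implicit Defensive.
Import GRing.Theory.

(** * Partial derivatives of variables and powers *)

Lemma mderivXU (K : fieldType) N (i j : 'I_N) :
  ('X_j)^`M(i) = (i == j)%:R :> {mpoly K[N]}.
Proof.
rewrite mderivX mnm1E eq_sym; case: eqVneq => [-> | _]; last by rewrite scale0r.
by rewrite scale1r -[X in (X - _)%MM]add0m addmK mpolyX0.
Qed.

Lemma mderiv_exp (K : fieldType) N (i : 'I_N) (f : {mpoly K[N]}) k :
  (f ^+ k.+1)^`M(i) = (f ^+ k * f^`M(i)) *+ k.+1.
Proof.
elim: k => [|k IH]; first by rewrite expr0 mul1r.
rewrite exprS mderivM IH mulrnAr mulrA -exprS mulrC.
by rewrite -mulrS.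
Qed.

(** * The action of polynomials on M as a module structure *)

Section PolynomialAction.

Context (K : fieldType) (N : nat) (M : lmodType K) (X : 'I_N -> {linear M -> M}).
Implicit Types (p q : {mpoly K[N]}) (m : 'X_{1..N}) (u v : M).

(** The support depends on the polynomial; a common finite index set lets the sums for several
    polynomials be compared term by term. *)
Lemma poly_actwE k p v : (msize p <= k)%N ->
  poly_act X p v = \sum_(m : 'X_{1..N < k}) p@_m *: mon_act X m v.
Proof.
move=> le_pk; pose I : subFinType _ := 'X_{1..N < k}.
rewrite /poly_act (big_mksub I) /=; first last.
- by move=> m /msize_mdeg_lt/leq_trans/(_ le_pk).
- by rewrite msupp_uniq.
rewrite big_rmcond //= => j /memN_msupp_eq0 ->.
by rewrite scale0r.
Qed.

Lemma poly_actDl p q v : poly_act X (p + q) v = poly_act X p v + poly_act X q v.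
Proof.
pose k := maxn (msize (p + q)) (maxn (msize p) (msize q)).
rewrite !(poly_actwE (k := k)) ?leq_max ?leqnn ?orbT // -big_split /=.
by apply: eq_bigr => m _; rewrite mcoeffD scalerDl.
Qed.

Lemma poly_actZl c p v : poly_act X (c *: p) v = c *: poly_act X p v.
Proof.
pose k := maxn (msize (c *: p)) (msize p).
rewrite !(poly_actwE (k := k)) ?leq_max ?leqnn ?orbT // scaler_sumr.
by apply: eq_bigr => m _; rewrite mcoeffZ scalerA.
Qed.

Lemma poly_act0l v : poly_act X 0 v = 0.
Proof. by rewrite /poly_act msupp0 big_nil. Qed.

Lemma poly_actXl m v : poly_act X 'X_[m] v = mon_act X m v.
Proof. by rewrite /poly_act msuppX big_seq1 mcoeffX eqxx scale1r. Qed.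

Lemma iter_linear (g : {linear M -> M}) k : linear (iter k g).
Proof. by elim: k => [|k IH] a u v //=; rewrite IH linearP. Qed.

Lemma mon_act_linear m : linear (mon_act X m).
Proof.
rewrite /mon_act => a u v; elim: (enum _) => //= i s ->.
exact: iter_linear.
Qed.

Lemma poly_act_linear p : linear (poly_act X p).
Proof.
move=> a u v; rewrite /poly_act scaler_sumr -big_split /=.
by apply: eq_bigr => m _; rewrite mon_act_linear scalerDr !scalerA mulrC.
Qed.

HB.instance Definition _ p :=
  GRing.isLinear.Build K M M _ (poly_act X p) (poly_act_linear p).

Lemma mon_act0 v : mon_act X 0 v = v.
Proof.
by rewrite /mon_act; elim: (enum _) => //= i s IH; rewrite mnm0E.
Qed.

Lemma poly_act1l v : poly_act X 1 v = v.
Proof. by rewrite -mpolyX0 poly_actXl mon_act0. Qed.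

Hypothesis XC : forall i j v, X i (X j v) = X j (X i v).

Lemma iterXC i j a b v :
  iter a (X i) (iter b (X j) v) = iter b (X j) (iter a (X i) v).
Proof.
have XaC c w : X i (iter c (X j) w) = iter c (X j) (X i w).
  by elim: c => //= c <-; rewrite XC.
by elim: a => //= a ->; rewrite XaC.
Qed.

(** Exponents add variable by variable; [iterC] moves a power of one variable past the product over
    the others, which is where commutativity enters. *)
Lemma mon_actD m1 m2 v : mon_act X (m1 + m2) v = mon_act X m1 (mon_act X m2 v).
Proof.
have iterC i a s w : iter a (X i) (foldr (fun i w => iter (m1 i) (X i) w) w s)
    = foldr (fun i w => iter (m1 i) (X i) w) (iter a (X i) w) s.
  by elim: s => //= j s <-; rewrite iterXC.
rewrite /mon_act; elim: (enum _) => //= i s ->.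
by rewrite mnmDE iterD iterC.
Qed.

Lemma mon_actU i v : mon_act X U_(i) v = X i v.
Proof.
have notin s : i \notin s ->
    foldr (fun j w => iter ((U_(i))%MM j) (X j) w) v s = v.
  elim: s => //= j s IH; rewrite inE negb_or => /andP[ij /IH ->].
  by rewrite mnm1E (negbTE ij).
rewrite /mon_act; have := mem_enum 'I_N i; have := enum_uniq 'I_N.
elim: (enum _) => //= j s IH /andP[js us]; rewrite inE mnm1E.
case: eqVneq js => [<- js _ | _ _] /=; last by move=> /IH ->.
by rewrite notin.
Qed.

Lemma poly_actMl p q v : poly_act X (p * q) v = poly_act X p (poly_act X q v).
Proof.
move: v; elim/mpolyind: p => [|c m p _ _ IHp] v; first by rewrite mul0r !poly_act0l.
rewrite mulrDl !poly_actDl IHp -scalerAl !poly_actZl; congr (_ *: _ + _).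
elim/mpolyind: q {IHp} => [|d m' q _ _ IHq].
  by rewrite mulr0 poly_act0l linear0.
rewrite mulrDr !poly_actDl linearD IHq -scalerAr !poly_actZl linearZ.
by rewrite /= -mpolyXD !poly_actXl mon_actD.
Qed.

Lemma poly_actC p q v :
  poly_act X p (poly_act X q v) = poly_act X q (poly_act X p v).
Proof. by rewrite -!poly_actMl mulrC. Qed.

Lemma poly_actMnl p k v : poly_act X (p *+ k) v = poly_act X p v *+ k.
Proof. by rewrite -scaler_nat poly_actZl scaler_nat. Qed.

End PolynomialAction.

(** * The commutator of a derivation with a polynomial, and its consequences for simple modules *)

Section Leibniz.

Context (K : fieldType) (N : nat) (M : lmodType K).
Context (X D : 'I_N -> {linear M -> M}) (weylM : weyl_module X D).
Implicit Types (p q f : {mpoly K[N]}) (u v w : M).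

Let XC : forall i j v, X i (X j v) = X j (X i v).
Proof. by case: weylM. Qed.

(** The polynomials obeying this rule are closed under products and linear combinations, and the
    Weyl relations put every variable among them. *)
Lemma weyl_leibniz i p v :
  D i (poly_act X p v) = poly_act X p (D i v) + poly_act X p^`M(i) v.
Proof.
pose L p := forall v,
  D i (poly_act X p v) = poly_act X p (D i v) + poly_act X p^`M(i) v.
have L1 : L 1.
  by move=> w; rewrite !poly_act1l -mpolyC1 mderivC poly_act0l addr0.
have LM p1 p2 : L p1 -> L p2 -> L (p1 * p2).
  move=> L1' L2 w; rewrite mderivM poly_actDl !poly_actMl // L1' L2.
  by rewrite linearD -addrA [X in _ + X]addrC.
have LX j : L 'X_j.
  move=> w; rewrite mderivXU !poly_actXl !mon_actU.
  have [_ _ /(_ i j w)/eqP] := weylM; rewrite subr_eq addrC => /eqP ->.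
  by case: eqVneq => _; rewrite ?poly_act1l ?poly_act0l.
move: v; elim/mpolyind: p => [|c m p _ _ IHp] v.
  by rewrite mderiv0 !poly_act0l linear0 addr0.
have Lm : L 'X_[m].
  rewrite mpolyXE_id; elim/big_ind: _ => // j _.
  by elim: (m j) => // k IHk; rewrite exprS; apply: LM.
rewrite mderivD mderivZ !poly_actDl !poly_actZl linearD linearZ /= IHp Lm.
by rewrite scalerDr addrACA.
Qed.

Lemma weyl_leibniz_exp i f k v :
  D i (poly_act X (f ^+ k.+1) v) = poly_act X (f ^+ k.+1) (D i v)
    + poly_act X (f ^+ k) (poly_act X f^`M(i) v) *+ k.+1.
Proof. by rewrite weyl_leibniz mderiv_exp poly_actMnl poly_actMl. Qed.

Hypothesis simpleM : weyl_simple X D.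

Lemma locally_nilpotent_submodule f :
  weyl_submodule X D (fun v => exists k, poly_act X (f ^+ k) v = 0).
Proof.
have act0 k l v : poly_act X (f ^+ k) v = 0 -> poly_act X (f ^+ (k + l)) v = 0.
  by rewrite addnC exprD poly_actMl // => ->; rewrite linear0.
split.
- by exists 0%N; rewrite linear0.
- move=> u v [k fu] [l fv]; exists (k + l)%N.
  by rewrite linearD /= act0 // addnC act0 // addr0.
- by move=> a v [k fv]; exists k; rewrite linearZ /= fv scaler0.
- move=> i v [k fv]; exists k.
  by rewrite -mon_actU -poly_actXl poly_actC // fv linear0.
(* One extra power is needed: in the Leibniz rule for [f ^+ k.+1] the derivative term still contains
   [f ^+ k], which kills v. *)
- move=> i v [k fv]; exists k.+1.
  have f1v : poly_act X (f ^+ k.+1) v = 0 by rewrite -addn1 act0.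
  have := weyl_leibniz_exp i f k v.
  by rewrite f1v linear0 poly_actC // fv linear0 mul0rn addr0.
Qed.

Lemma locally_nilpotent f u :
  u != 0 -> poly_act X f u = 0 -> forall v, exists k, poly_act X (f ^+ k) v = 0.
Proof.
move=> u0 fu; have [// | all0] := simpleM.2 _ (locally_nilpotent_submodule f).
have /eqP := all0 u (ex_intro _ 1%N fu).
by rewrite (negPf u0).
Qed.

Hypothesis K0 : [pchar K] =i pred0.

Lemma mulrSn_eq0 v k : v *+ k.+1 = 0 -> v = 0.
Proof.
move/eqP; rewrite -scaler_nat scaler_eq0 ((pcharf0P K).1 K0) /=.
by move/eqP.
Qed.

Lemma deriv_annihilates_nonzero i f k v : v != 0 -> D i v = 0 ->
  poly_act X (f ^+ k) v = 0 -> exists2 w, w != 0 & poly_act X f^`M(i) w = 0.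
Proof.
move=> v0 Dv; elim: k => [|k IH] fv.
  by move: v0 fv; rewrite poly_act1l => /eqP.
(* Descend to the last power of f not killing v; that vector is the witness. *)
have [/IH // | w0] := eqVneq (poly_act X (f ^+ k) v) 0.
exists (poly_act X (f ^+ k) v) => //.
have := weyl_leibniz_exp i f k v.
by rewrite fv Dv !linear0 add0r poly_actC // => /esym /mulrSn_eq0.
Qed.

(* The one-variable model is [f' / f], whose residues show that it has no
   primitive in [K[x]_f / K[x]]. *)
Lemma deriv_no_primitive i f u w k :
  (forall v, poly_act X f^`M(i) v = 0 -> v = 0) ->
  poly_act X f u = 0 -> D i w = poly_act X f^`M(i) u ->
  poly_act X (f ^+ k) w = 0 -> u = 0.
Proof.
move=> injf' fu Dw; elim: k => [|k IH] fw.
  by apply: injf'; rewrite -Dw; move: fw; rewrite poly_act1l => ->; rewrite linear0.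
apply: IH; apply: injf'; apply: (@mulrSn_eq0 _ k).
have := weyl_leibniz_exp i f k w.
(* The first Leibniz term is f^(k+1) f' u = f' f^k (f u) = 0. *)
rewrite fw Dw linear0 poly_actC // exprSr poly_actMl // fu !linear0 add0r.
by rewrite poly_actC // => /esym.
Qed.

Context (P : {mpoly K[N]} -> Prop) (u : M).
Hypotheses (u0 : u != 0) (annu : forall p, P p <-> ann_R X u p).
Hypothesis primeP : is_prime_ideal P.

(** Local nilpotence at u puts a power of f in Ann(u) = P, and primality extracts f. *)
Lemma annihilator_mem f v : v != 0 -> poly_act X f v = 0 -> P f.
Proof.
move=> v0 fv; have [k /annu Pfk] := locally_nilpotent v0 fv u.
have [_ P1 PM] := primeP.
by elim: k Pfk => // k IH; rewrite exprS => /PM[|/IH].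
Qed.

Lemma deriv_stable_of_H1 i : H1_nonzero (D i) -> forall f, P f -> P f^`M(i).
Proof.
move=> [v [v0 Dv]] f /annu fu.
have [k fkv] := locally_nilpotent u0 fu v.
by have [w w0 /(annihilator_mem w0)] := deriv_annihilates_nonzero v0 Dv fkv.
Qed.

Lemma deriv_stable_of_H0 i : H0_vanishes (D i) -> forall f, P f -> P f^`M(i).
Proof.
move=> onto f /annu fu; apply/annu/eqP/negPn/negP => f'u.
have injf' v : poly_act X f^`M(i) v = 0 -> v = 0.
  move=> f'v; apply/eqP/negPn/negP => v0.
  by move: f'u; rewrite (annu _).1 ?eqxx //; apply: annihilator_mem v0 f'v.
have [w Dw] := onto (poly_act X f^`M(i) u).
have [k fkw] := locally_nilpotent u0 fu w.
by move: u0; rewrite (deriv_no_primitive injf' fu (esym Dw) fkw) eqxx.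
Qed.

End Leibniz.

(** * Derivation-stable ideals are extended from the smaller polynomial ring *)

Section Extension.

Context (K : fieldType) (n : nat).
Implicit Types (p : {mpoly K[n.+1]}) (a b : {poly {mpoly K[n]}}).

(** The canonical map from R_{n-1}[X_n] to R; the univariate side gives access to the degree and
    leading coefficient in X_n. *)
Definition widen_poly a : {mpoly K[n.+1]} :=
  (map_poly (@mwiden n K) a).['X_ord_max].

Lemma widen_polyD a b : widen_poly (a + b) = widen_poly a + widen_poly b.
Proof. by rewrite /widen_poly rmorphD hornerD. Qed.

Lemma widen_polyM a b : widen_poly (a * b) = widen_poly a * widen_poly b.
Proof. by rewrite /widen_poly rmorphM hornerM. Qed.

Lemma widen_polyC c : widen_poly c%:P = mwiden c.
Proof. by rewrite /widen_poly map_polyC hornerC. Qed.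

Lemma widen_polyX : widen_poly 'X = 'X_ord_max.
Proof. by rewrite /widen_poly map_polyX hornerX. Qed.

(** The image is a subring containing the constants and all variables: the last one comes from ['X],
    the others from constant polynomials. *)
Lemma widen_poly_surj p : exists a, p = widen_poly a.
Proof.
pose S p := exists a, p = widen_poly a.
have SC c : S c%:MP by exists c%:MP%:P; rewrite widen_polyC mwidenC.
have SM p1 p2 : S p1 -> S p2 -> S (p1 * p2).
  by move=> [a ->] [b ->]; exists (a * b); rewrite widen_polyM.
have SX i : S 'X_i.
  have [j -> | ->] := unliftP ord_max i; last by exists 'X; rewrite widen_polyX.
  exists ('X_j)%:P; rewrite widen_polyC mwidenX mnmwiden1.
  by congr 'X_[U_(_)]; apply: val_inj; exact: lift_max.
elim/mpolyind: p => [|c m p _ _ [a ->]]; first by rewrite -mpolyC0; apply: SC.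
have [b ->] : S (c *: 'X_[m]).
  rewrite -mul_mpolyC; apply: (SM); rewrite ?mpolyXE_id //.
  elim/big_ind: _ => [||i _]; [exact: SC 1 | exact: SM |].
  by elim: (m i) => [|k IHk]; [exact: SC 1 | rewrite exprS; apply: SM].
by exists (b + a); rewrite widen_polyD.
Qed.

Lemma mderiv_mwiden c : (mwiden c)^`M(ord_max) = 0 :> {mpoly K[n.+1]}.
Proof.
elim/mpolyind: c => [|a m c _ _ IH]; first by rewrite mwiden0 mderiv0.
by rewrite mwidenD mwidenZ mwidenX mderivD mderivZ mderivX IH
  mnmwiden_ordmax scale0r scaler0 addr0.
Qed.

Lemma mderiv_widen_poly a : (widen_poly a)^`M(ord_max) = widen_poly a^`().
Proof.
elim/poly_ind: a => [|a c IH]; first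
  by rewrite deriv0 /widen_poly rmorph0 horner0 mderiv0.
rewrite widen_polyD widen_polyM widen_polyC widen_polyX derivD derivM derivX derivC.
rewrite mderivD mderivM mderiv_mwiden IH mderivXU eqxx !addr0.
by rewrite !mulr1 widen_polyD widen_polyM widen_polyX.
Qed.

Lemma extend_idealDM (Q : {mpoly K[n]} -> Prop) p q r :
  extend_ideal Q p -> Q q -> extend_ideal Q (p + r * mwiden q).
Proof.
move=> [s [Qs ->]] Qq; exists ((r, q) :: s); split; last first.
  by rewrite big_cons addrC.
by move=> x; rewrite inE => /predU1P[-> | /Qs].
Qed.

Lemma extend_contract (P : {mpoly K[n.+1]} -> Prop) p :
  is_ideal P -> extend_ideal (contract_ideal P) p -> P p.
Proof.
move=> [P0 PD PM] [s [Qs ->]]; elim: s Qs => [|x s IH] Qs.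
  by rewrite big_nil.
rewrite big_cons; apply: PD; first by apply/PM/Qs; rewrite inE eqxx.
by apply: IH => y ys; apply: Qs; rewrite inE ys orbT.
Qed.

(** Induction on the degree in X_n: once the leading coefficient is known to lie in the contraction,
    removing the leading term leaves a smaller member of P. *)
Lemma deriv_stable_extended (P : {mpoly K[n.+1]} -> Prop) :
  [pchar K] =i pred0 -> is_ideal P -> (forall p, P p -> P p^`M(ord_max)) ->
  forall p, P p <-> extend_ideal (contract_ideal P) p.
Proof.
move=> K0 idP PD' p; split=> [|/(extend_contract idP) //].
have [P0 PD PM] := idP; have [a -> {p}] := widen_poly_surj p.
have [k] := ubnP (size a); elim: k a => // k IH a; rewrite ltnS => sa Pa.
(* Zero is treated apart, since removing a leading term must strictly lower the size. *)
have [sa0 | sa_gt0] := posnP (size a).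
  move/eqP: sa0; rewrite size_poly_eq0 => /eqP ->; exists [::].
  by rewrite /widen_poly rmorph0 horner0 big_nil.
set d := (size a).-1; set c := a`_d.
have Pder j : P (widen_poly a^`(j)).
  by elim: j => [|j /PD']; rewrite ?derivn0 // mderiv_widen_poly -derivnS.
(* As d is the degree of a, its d-th derivative is the constant d! c, and d! is invertible in
   characteristic zero. *)
have Qc : P (mwiden c).
  have := Pder d; have -> : a^`(d) = (c *+ d`!)%:P.
    apply/polyP=> j; rewrite coef_derivn coefC; case: j => [|j] /=.
      by rewrite addn0 ffactnn.
    by rewrite nth_default ?mul0rn // -(prednK sa_gt0) addnS ltnS leq_addr.
  rewrite widen_polyC mwidenMn => /(PM (d`!%:R^-1)%:MP).
  rewrite mul_mpolyC -scaler_nat scalerA mulVf ?scale1r //.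
  by rewrite ((pcharf0P K).1 K0) -lt0n fact_gt0.
pose b := a - c%:P * 'X^d.
have aE : a = b + 'X^d * c%:P by rewrite /b [c%:P * _]mulrC subrK.
have Pb : P (widen_poly b).
  rewrite /b -mulNr -polyCN mulrC widen_polyD widen_polyM widen_polyC mwidenN.
  rewrite mulrN -mulNr; exact/PD/PM.
have sb : (size b < k)%N.
  apply: leq_trans sa; rewrite -(prednK sa_gt0) ltnS.
  apply/leq_sizeP=> j; rewrite leq_eqVlt => /orP[/eqP <- | dj].
    by rewrite coefB coefCM coefXn eqxx mulr1 subrr.
  rewrite coefB coefCM coefXn gtn_eqF // mulr0 subr0 nth_default //.
  by rewrite -(prednK sa_gt0).
rewrite aE widen_polyD widen_polyM widen_polyC.
by apply: extend_idealDM => //; apply: IH.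
Qed.

End Extension.

(* The Weyl algebra A_{n+1}(K) in variables x_0..x_n; the last variable
   x_n = ord_max and d_n = D ord_max play the role of X_n, ∂_n of the paper. *)
Theorem theorem7p1 (K : fieldType) (n : nat) (M : lmodType K)
    (X D : 'I_n.+1 -> {linear M -> M}) (P : {mpoly K[n.+1]} -> Prop) :
  [pchar K] =i pred0 ->
  weyl_module X D ->
  weyl_simple X D ->
  Ass_singleton X P ->
  (H0_vanishes (D ord_max) ->
     forall p, P p <-> extend_ideal (contract_ideal P) p) /\
  (H1_nonzero (D ord_max) ->
     forall p, P p <-> extend_ideal (contract_ideal P) p).
Proof.
(* Taking I = P in the hypothesis on Ass(M) makes P itself associated, hence P = Ann(u); u is
   nonzero because 1 is not in P. *)
move=> K0 weylM simpleM /(_ P)[_ /(_ (fun=> iff_refl _))[primeP [u annu]]].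
have [idP P1 _] := primeP.
have u0 : u != 0.
  by apply/eqP => u0; apply/P1/annu; rewrite /ann_R u0 linear0.
split=> H; apply: deriv_stable_extended => //.
- exact: (deriv_stable_of_H0 weylM simpleM K0 u0 annu primeP H).
- exact: (deriv_stable_of_H1 weylM simpleM K0 u0 annu primeP H).
Qed.
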